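(* Let $A\in \mathsf{Mat}_{m \times t}(\mathbb{F}_{q})$ be a superregular matrix and let $B\in \mathsf{Mat}_{n \times n}(\mathbb{F}_{q})$ be a non-singular matrix. Then the matrix $M=A\otimes B \in \mathsf{Mat}_{mn \times tn}(\mathbb{F}_{q})$ is an $n$-block superregular matrix.
   Context: $\mathbb{F}_q$ is the finite field with $q$ elements, $q$ a prime power. A matrix over a field is superregular if every square submatrix of it (of any size, obtained by choosing arbitrary rows and equally many arbitrary columns) is non-singular; in particular all its entries are nonzero. A matrix $A=[A_{ij}]\in \mathsf{Mat}_{bm\times bt}(\mathbb{F}_q)$, partitioned into blocks $A_{ij}$ of size $b\times b$, is $b$-block superregular if every square submatrix consisting of full blocks $A_{ij}$ (i.e. obtained by choosing some block rows and equally many block columns) is non-singular over $\mathbb{F}_q$. $A\otimes B$ is the Kronecker product, i.e. the block matrix whose $(i,j)$ block is $a_{ij}B$. *)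

(* Defs.v *)
From mathcomp Require Import all_boot all_order all_algebra.
From mathcomp Require Import mxtens.
Set Implicit Arguments.
Unset Strict Implicit.
Unset Printing Implicit Defensive.
Import GRing.Theory.
Local Open Scope ring_scope.

(* A submatrix is selected by strictly increasing maps f, g on the row and    *)
(* column indices.  The case k = 0 imposes nothing, since an empty square     *)
(* matrix has determinant 1.                                                  *)
Definition superregular (F : fieldType) (m t : nat) (A : 'M[F]_(m, t)) : Prop :=
  forall (k : nat) (f : 'I_k -> 'I_m) (g : 'I_k -> 'I_t),
    {homo f : i j / (i < j)%N} -> {homo g : i j / (i < j)%N} ->
    mxsub f g A \in unitmx.

(* A matrix of size (m * b) x (t * b) is partitioned into b x b blocks by     *)
(* mxtens_index (i, u), whose value is i * b + u: position u of block i.      *)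
(* block_index f sends position u of block i to position u of block f i.      *)
Definition block_index (b k m : nat) (f : 'I_k -> 'I_m) (x : 'I_(k * b)) :
    'I_(m * b) :=
  mxtens_index (f (mxtens_unindex x).1, (mxtens_unindex x).2).

Definition block_superregular (F : fieldType) (b m t : nat)
    (M : 'M[F]_(m * b, t * b)) : Prop :=
  forall (k : nat) (f : 'I_k -> 'I_m) (g : 'I_k -> 'I_t),
    {homo f : i j / (i < j)%N} -> {homo g : i j / (i < j)%N} ->
    mxsub (@block_index b k m f) (@block_index b k t g) M \in unitmx.

(* Main.v *)
Require Import Defs.
From mathcomp Require Import all_boot all_order all_algebra.
From mathcomp Require Import mxtens.
Local Open Scope ring_scope.

(** Choosing full blocks of [A *t B] amounts to choosing entries of [A]: the
    selected submatrix is again a Kronecker product, of the corresponding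
    submatrix of [A] with [B] ([mxsub_block_index_tensmx]).  Superregularity
    makes the first factor invertible, [B] is invertible by hypothesis, and a
    Kronecker product of invertible matrices has the Kronecker product of the
    inverses as its inverse ([unitmx_tensmx]). *)

Lemma tensmx11 (R : pzRingType) (m n : nat) :
  (1%:M : 'M[R]_m) *t (1%:M : 'M[R]_n) = 1%:M.
Proof.
apply/matrixP=> i j.
case: (mxtens_indexP i) => i1 i2; case: (mxtens_indexP j) => j1 j2.
rewrite tensmxE !mxE -GRing.natrM mulnb.
by rewrite (can_eq (@mxtens_indexK m n)) xpair_eqE.
Qed.

(** Unlike [tensmx_unit], this covers factors of size 0: the empty selection of
    blocks and the empty matrix [B] both give an empty Kronecker product. *)
Lemma unitmx_tensmx (R : comUnitRingType) (m n : nat)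
    (A : 'M[R]_m) (B : 'M[R]_n) :
  A \in unitmx -> B \in unitmx -> A *t B \in unitmx.
Proof.
move=> uA uB.
have: (invmx A *t invmx B) *m (A *t B) = 1%:M.
  by rewrite tensmx_mul !mulVmx // tensmx11.
by case/mulmx1_unit.
Qed.

Lemma mxsub_block_index_tensmx (R : pzRingType) (m t n p k l : nat)
    (f : 'I_k -> 'I_m) (g : 'I_l -> 'I_t) (A : 'M[R]_(m, t)) (B : 'M[R]_(n, p)) :
  mxsub (@block_index n k m f) (@block_index p l t g) (A *t B)
  = mxsub f g A *t B.
Proof. by apply/matrixP=> x y; rewrite mxE tensmxE !mxE. Qed.

Theorem theorem3 (F : finFieldType) (m t n : nat)
    (A : 'M[F]_(m, t)) (B : 'M[F]_n) (hA : superregular A)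
    (hB : B \in unitmx) :
  @block_superregular F n m t (A *t B).
Proof.
move=> k f g f_incr g_incr.
rewrite mxsub_block_index_tensmx.
by apply: unitmx_tensmx => //; apply: hA.
Qed.
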